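(* Let $\underline{A},\overline{A}\in\mathbb{R}^{n\times n}$ with $\underline{A}\le\overline{A}$ (entrywise), let $\mathbf{A}=\{A\in\mathbb{R}^{n\times n} : \underline{A}\le A\le\overline{A}\}$, and let $A^c=\frac12(\underline{A}+\overline{A})$. Assume that $A^c$ is an $M$-matrix. Then $\mathbf{A}$ is strongly an $R_0$-matrix if and only if $\mathbf{A}$ is strongly an $H$-matrix.
   Context: All inequalities between vectors or matrices are entrywise. A matrix property holds strongly for an interval matrix $\mathbf{A}$ if it holds for every $A\in\mathbf{A}$. For index sets $I,J$, $A_{I,J}$ is the submatrix of $A$ with rows indexed by $I$ and columns indexed by $J$. A matrix $A\in\mathbb{R}^{n\times n}$ is an $R_0$-matrix if the linear complementarity problem $y=Az$, $y,z\ge0$, $y^Tz=0$ has only the solution $z=0$; equivalently, if for each $\emptyset\ne I\subseteq\{1,\dots,n\}$, with $J:=\{1,\dots,n\}\setminus I$, the system $A_{I,I}x=0$, $A_{J,I}x\ge0$, $x>0$ is infeasible. A matrix $A$ is an $M$-matrix if $A=sI_n-N$ for some $N\ge0$ and $s\in\mathbb{R}$ with $s>\rho(N)$, where $\rho$ is the spectral radius. A matrix $A$ is an $H$-matrix if its comparison matrix $\langle A\rangle$, given by $\langle A\rangle_{ii}=|a_{ii}|$ and $\langle A\rangle_{ij}=-|a_{ij}|$ for $i\ne j$, is an $M$-matrix. *)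

(* Defs.v *)
From HB Require Import structures.
From mathcomp Require Import all_boot all_order all_algebra.
From mathcomp Require Import classical_sets reals.
From mathcomp Require Import complex.

Set Implicit Arguments.
Unset Strict Implicit.
Unset Printing Implicit Defensive.

Import Order.TTheory GRing.Theory Num.Theory.

Local Open Scope classical_set_scope.
Local Open Scope ring_scope.

Definition lemx (R : realType) (m n : nat) (A B : 'M[R]_(m, n)) : Prop :=
  forall i j, A i j <= B i j.

Definition interval_mx (R : realType) (n : nat) (Al Au : 'M[R]_n) :
    set 'M[R]_n :=
  [set A | lemx Al A /\ lemx A Au].

Definition midpoint_mx (R : realType) (n : nat) (Al Au : 'M[R]_n) : 'M[R]_n :=
  2^-1 *: (Al + Au).

Definition strongly (R : realType) (n : nat) (P : 'M[R]_n -> Prop)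
    (AA : set 'M[R]_n) : Prop :=
  forall A, AA A -> P A.

Definition R0_matrix (R : realType) (n : nat) (A : 'M[R]_n) : Prop :=
  forall y z : 'cV[R]_n,
    y = A *m z -> lemx 0 y -> lemx 0 z -> y^T *m z = 0 -> z = 0.

(* The eigenvalues are the complex ones.  They form a finite set, nonempty when
   0 < n, so this supremum is a maximum; it is 0 when n = 0. *)
Definition spectral_radius (R : realType) (n : nat) (N : 'M[R]_n) : R :=
  sup [set ComplexField.Normc.normc l | l in
        [set l : R[i] | eigenvalue (map_mx (real_complex R) N) l]].

Definition M_matrix (R : realType) (n : nat) (A : 'M[R]_n) : Prop :=
  exists (N : 'M[R]_n) (s : R),
    [/\ lemx 0 N, spectral_radius N < s & A = s%:M - N].

Definition comparison_mx (R : realType) (n : nat) (A : 'M[R]_n) : 'M[R]_n :=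
  \matrix_(i, j) (if i == j then `|A i j| else - `|A i j|).

Definition H_matrix (R : realType) (n : nat) (A : 'M[R]_n) : Prop :=
  M_matrix (comparison_mx A).

(* Main.v *)
(** A matrix with nonpositive off-diagonal entries is an M-matrix iff it is
    semipositive, i.e. [A x > 0] for some [x >= 0].  Follow the segment from
    [A^c] to the lower bound of the interval.  Semipositivity is an open
    condition along it, and it can only be lost at a matrix with a nonzero
    nonnegative kernel vector, which the R_0 property excludes.  So the lower
    bound is semipositive, and it is below every comparison matrix of the
    interval.  Conversely, a solution [z] of the complementarity problem for
    [A] satisfies [<A> z <= 0], hence [z <= 0] by inverse positivity of [<A>]. *)
Require Import Defs.
From mathcomp Require Import all_boot all_order all_algebra.
From mathcomp Require Import classical_sets reals.
From mathcomp Require Import complex topology normedtype derive.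
From mathcomp Require Import ring lra.

Set Implicit Arguments.
Unset Strict Implicit.
Unset Printing Implicit Defensive.

Import Order.TTheory GRing.Theory Num.Theory.
Import numFieldNormedType.Exports.

Local Open Scope classical_set_scope.
Local Open Scope ring_scope.

(** * Z-matrices and semipositivity *)

Definition Z_matrix (R : realType) (n : nat) (A : 'M[R]_n) : Prop :=
  forall i j, i != j -> A i j <= 0.

Definition semipositive (R : realType) (n : nat) (A : 'M[R]_n) : Prop :=
  exists2 x : 'cV[R]_n, lemx 0 x & forall i, 0 < (A *m x) i 0.

Lemma lemx0P (R : realType) (n : nat) (x : 'cV[R]_n) :
  lemx 0 x <-> forall i, 0 <= x i 0.
Proof.
split=> x0 i; first by have := x0 i 0; rewrite mxE.
by move=> j; rewrite ord1 mxE.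
Qed.

Lemma finite_lower_bound (R : realType) (T : finType) (f : T -> R) :
  (forall i, 0 < f i) -> exists2 m, 0 < m & forall i, m <= f i.
Proof.
move=> f0; exists (\big[Num.min/1]_i f i); last by move=> i; exact: bigmin_le_cond.
by apply: lt_bigmin.
Qed.

(** If [x i 0 = 0], row [i] of [A *m x] keeps only off-diagonal terms, all nonpositive. *)
Lemma Z_semipositive_gt0 (R : realType) (n : nat) (A : 'M[R]_n)
    (x : 'cV[R]_n) :
  Z_matrix A -> lemx 0 x -> (forall i, 0 < (A *m x) i 0) -> forall i, 0 < x i 0.
Proof.
move=> ZA /lemx0P x0 Ax i; rewrite lt_neqAle x0 andbT eq_sym.
apply/eqP => xi0; have := Ax i.
rewrite mxE (bigD1 i) //= xi0 mulr0 add0r ltNge => /negP; apply.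
by apply: sumr_le0 => j ji; rewrite mulr_le0_ge0 // ZA // eq_sym.
Qed.

(** Ratio argument: if the minimum [c] of [z k 0 / x k 0] is negative, [z - c *: x] is nonnegative
    and vanishes at a minimizing [k]. The sign pattern makes entry [k] of its image nonpositive,
    while [A z >= 0], [A x > 0] and [c < 0] make it positive. *)
Lemma Z_semipositive_monotone (R : realType) (n : nat) (A : 'M[R]_n)
    (z : 'cV[R]_n) :
  Z_matrix A -> semipositive A -> lemx 0 (A *m z) -> lemx 0 z.
Proof.
move=> ZA [x x0 Ax] /lemx0P Az; have {}x0 := Z_semipositive_gt0 ZA x0 Ax.
apply/lemx0P => i0; rewrite leNgt; apply/negP => zi0.
have [k _ kmin] := @Order.TotalTheory.arg_minP _ R _ i0 xpredT
  (fun i => z i 0 / x i 0) isT.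
set c := z k 0 / x k 0 in kmin.
have c0 : c < 0 by apply: le_lt_trans (kmin i0 isT) _; rewrite pmulr_llt0 ?invr_gt0.
have w0 j : 0 <= (z - c *: x) j 0.
  by rewrite !mxE subr_ge0 -ler_pdivlMr //; exact: kmin.
have wk : (z - c *: x) k 0 = 0 by rewrite !mxE divfK ?subrr // gt_eqF.
have : (A *m (z - c *: x)) k 0 <= 0.
  rewrite mxE (bigD1 k) //= wk mulr0 add0r.
  by apply: sumr_le0 => j jk; rewrite mulr_le0_ge0 // ZA // eq_sym.
apply/negP; rewrite -ltNge mulmxBr -scalemxAr.
have -> : (A *m z - c *: (A *m x)) k 0 = (A *m z) k 0 - c * (A *m x) k 0.
  by rewrite !mxE.
by rewrite ltr_wpDl // oppr_gt0 nmulr_rlt0.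
Qed.

(** Monotonicity makes a kernel vector and its opposite both nonnegative. The transposition is there
    because [kermx] is a left kernel. *)
Lemma Z_semipositive_unitmx (R : realType) (n : nat) (A : 'M[R]_n) :
  Z_matrix A -> semipositive A -> A \in unitmx.
Proof.
move=> ZA SA; rewrite -unitmx_tr -row_free_unit -kermx_eq0.
apply/eqP/row_matrixP => i; rewrite row0.
set v := row i _.
have Av : A *m v^T = 0.
  apply: trmx_inj; rewrite trmx_mul trmxK trmx0.
  by apply/sub_kermxP; exact: row_sub.
have v0 : lemx 0 v^T by apply: (Z_semipositive_monotone ZA SA); rewrite Av.
have v0' : lemx 0 (- v^T).
  by apply: (Z_semipositive_monotone ZA SA); rewrite mulmxN Av oppr0.
apply/rowP => j; apply/le_anti; rewrite mxE.
by have := v0 j 0; have := v0' j 0; rewrite !mxE oppr_ge0 => -> ->.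
Qed.

(** * Semipositivity along a segment of matrices *)

Lemma continuous_sum (R : realType) (T : topologicalType) (I : finType)
    (F : I -> T -> R) :
  (forall i, continuous (F i)) -> continuous (fun x => \sum_i F i x).
Proof.
by move=> cF; apply: (continuous_big (@tvs.add_continuous R)) => i _; exact: cF.
Qed.

(** The 1-norm of [B x] is continuous and positive on the standard simplex, which is compact, so its
    minimum there is positive. Homogeneity carries the bound to all [x >= 0]. *)
Lemma no_nonneg_kernel_bound (R : realType) (n : nat) (B : 'M[R]_n) :
  (forall x : 'cV[R]_n, lemx 0 x -> B *m x = 0 -> x = 0) ->
  exists2 c, 0 < c & forall x : 'cV[R]_n, lemx 0 x ->
    c * \sum_i x i 0 <= \sum_i `|(B *m x) i 0|.
Proof.
case: n B => [B _|n B Bker].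
  by exists 1 => // x _; rewrite !big_ord0 mulr0.
pose cube := [set v : 'rV[R]_n.+1 | forall i, [set` `[0, 1]] (v ord0 i)].
pose f (v : 'rV[R]_n.+1) : R := \sum_i `|\sum_j B i j * v 0 j|.
pose g (v : 'rV[R]_n.+1) := \sum_i v 0 i.
have cont_g : continuous g.
  by apply: continuous_sum => i; exact: coord_continuous.
have cont_f : continuous f.
  apply: continuous_sum => i v.
  have h : continuous (fun w : 'rV[R]_n.+1 => \sum_j B i j * w 0 j).
    apply: continuous_sum => j w.
    exact: (cvgM (cvg_cst _) (@coord_continuous R 1 n.+1 0 j w)).
  exact: (cvg_norm (h v)).
have cK : compact (cube `&` g @^-1` [set 1]).
  apply: compact_closedI.
    exact: (@rV_compact R n.+1 (fun=> [set` `[0, 1]]) (fun=> @segment_compact R 0 1)).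
  apply: closed_comp => [v _|]; [exact: cont_g|exact: closed_eq].
have K0 : cube `&` g @^-1` [set 1] !=set0.
  exists (delta_mx 0 0); split=> /=.
    by move=> i; rewrite !mxE /= in_itv/= ler0n lern1 leq_b1.
  rewrite /g (bigD1 0) //= big1 ?mxE ?eqxx ?addr0 // => i i0.
  by rewrite mxE (negbTE i0) andbF.
have [u uK umin] := EVT_min_rV K0 cK (continuous_subspaceT cont_f).
move: uK; rewrite inE => -[u01 /= gu].
have fE (x : 'cV[R]_n.+1) : f x^T = \sum_i `|(B *m x) i 0|.
  by apply: eq_bigr => i _; rewrite mxE; congr (`|_|); apply: eq_bigr => j _; rewrite mxE.
exists (f u).
  rewrite lt_neqAle eq_sym; apply/andP; split; last by apply: sumr_ge0.
  apply/eqP => fu0.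
  have Bu : B *m u^T = 0.
    apply/colP => i; rewrite [RHS]mxE; apply/eqP; rewrite -normr_eq0; apply/eqP.
    move: fu0; rewrite -{1}[u]trmxK fE => /eqP.
    by rewrite psumr_eq0 // => /allP/(_ i); rewrite mem_index_enum => /(_ isT)/eqP.
  have : u^T = 0.
    apply: Bker Bu; apply/lemx0P => i; rewrite mxE.
    by have := u01 i; rewrite /= in_itv/= => /andP[].
  move=> /(congr1 trmx); rewrite trmxK trmx0 => u0.
  move: gu; rewrite u0 /g big1 => [/esym/eqP|i _]; last by rewrite mxE.
  by rewrite oner_eq0.
move=> x /lemx0P x0; have S0 : 0 <= \sum_i x i 0 by apply: sumr_ge0.
have [S0'|Sn0] := eqVneq (\sum_i x i 0) 0.
  by rewrite S0' mulr0 sumr_ge0.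
set S := \sum_i x i 0 in S0 Sn0 *.
have Sp : 0 < S by rewrite lt_neqAle eq_sym Sn0.
rewrite -ler_pdivlMr // mulrC mulr_sumr.
have <- : f (S^-1 *: x)^T = \sum_i S^-1 * `|(B *m x) i 0|.
  rewrite fE; apply: eq_bigr => i _.
  by rewrite -scalemxAr mxE normrM gtr0_norm ?invr_gt0.
apply: umin; rewrite inE; split=> /=.
  move=> i; rewrite !mxE /= in_itv /= mulr_ge0 ?invr_ge0 //=.
  by rewrite mulrC ler_pdivrMr // mul1r /S (bigD1 i) //= lerDl sumr_ge0.
rewrite /g -[RHS](mulVf Sn0) /S mulr_sumr.
by apply: eq_bigr => i _; rewrite !mxE.
Qed.

Lemma mulmx_pencilE (R : realType) (n : nat) (A D : 'M[R]_n) (t : R)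
    (x : 'cV[R]_n) i :
  ((A - t *: D) *m x) i 0 = (A *m x) i 0 - t * (D *m x) i 0.
Proof.
by rewrite mulmxBl -scalemxAl; move: (A *m x) (D *m x) => a d; rewrite !mxE.
Qed.

(** The same [x] serves for every nearby [u]: no entry of its image moves by as much as the lower
    bound [m]. *)
Lemma semipositive_open (R : realType) (n : nat) (A D : 'M[R]_n) (t : R) :
  semipositive (A - t *: D) ->
  exists2 e, 0 < e & forall u, `|u - t| <= e -> semipositive (A - u *: D).
Proof.
move=> [x x0 Ax]; have [m m0 mA] := finite_lower_bound Ax.
pose K := \sum_i `|(D *m x) i 0|.
have K0 : 0 <= K by apply: sumr_ge0.
(* [K + 1] instead of [K] keeps the quotient meaningful when [K = 0] and gives the strict
   [m K / (K + 1) < m]. *)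
exists (m / (K + 1)); first by rewrite divr_gt0 // ltr_wpDl.
move=> u ut; exists x => // i.
have -> : A - u *: D = A - t *: D - (u - t) *: D.
  by rewrite scalerBl opprB addrA subrK.
rewrite mulmx_pencilE subr_gt0.
apply: lt_le_trans (mA i); apply: le_lt_trans (ler_norm _) _.
rewrite normrM; apply: le_lt_trans (_ : m / (K + 1) * K < _).
  by rewrite ler_pM // /K (bigD1 i) //= lerDl sumr_ge0.
by rewrite mulrAC ltr_pdivrMr ?ltr_wpDl // ltr_pM2l // ltrDl.
Qed.

(* If [B] kills no nonzero [x >= 0], then the solutions [x] of
   [(B + h D) x = 1] stay bounded as [h] tends to 0, so [B x] tends to 1. *)
Lemma semipositive_closed (R : realType) (n : nat) (B D : 'M[R]_n) :
  (forall x : 'cV[R]_n, lemx 0 x -> B *m x = 0 -> x = 0) ->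
  exists2 e, 0 < e & forall h, 0 <= h <= e ->
    Z_matrix (B + h *: D) -> semipositive (B + h *: D) -> semipositive B.
Proof.
move=> /no_nonneg_kernel_bound[c c0 cB].
pose K := \sum_i \sum_j `|D i j|.
have K0 : 0 <= K by apply: sumr_ge0 => i _; apply: sumr_ge0.
(* With [s] the sum of the entries of [x] and [q = h K s], this choice yields
   [4 (n + 1) q <= c s <= n + q], hence [q < 1]. Each entry [1 - h (D x)_i] of [B x] is then
   positive. *)
pose e := c / (4 * (n%:R + 1) * (K + 1)).
have d0 : 0 < 4 * (n%:R + 1) * (K + 1) :> R.
  by rewrite !mulr_gt0 // ltr_wpDl.
exists e; first by rewrite divr_gt0.
move=> h /andP[h0 he] ZB SB.
have UB := Z_semipositive_unitmx ZB SB.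
pose x := invmx (B + h *: D) *m (const_mx 1 : 'cV[R]_n).
have Bx : (B + h *: D) *m x = const_mx 1 by rewrite mulKVmx.
have x0 : lemx 0 x.
  by apply: (Z_semipositive_monotone ZB SB); rewrite Bx; apply/lemx0P => i; rewrite mxE.
exists x => // i.
have BxE k : (B *m x) k 0 = 1 - h * (D *m x) k 0.
  have /colP/(_ k) := Bx; rewrite -{1}[h]opprK scaleNr mulmx_pencilE mulNr opprK.
  by rewrite [RHS]mxE => <-; rewrite addrK.
have S0 : 0 <= \sum_i x i 0 by apply: sumr_ge0 => k _; move/lemx0P: x0.
have Dxk k : `|(D *m x) k 0| <= (\sum_j `|D k j|) * \sum_i x i 0.
  rewrite mxE; apply: le_trans (ler_norm_sum _ _ _) _.
  rewrite mulr_suml ler_sum // => j _; rewrite normrM ler_wpM2l //.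
  move/lemx0P: x0 => x0; rewrite ger0_norm // (bigD1 j) //= lerDl.
  by apply: sumr_ge0.
have := cB _ x0; set s := \sum_i x i 0 in S0 Dxk *.
have hKs : h * K * s * (4 * (n%:R + 1)) <= c * s.
  rewrite mulrAC ler_wpM2r //.
  move: he; rewrite /e ler_pdivlMr // => /(le_trans _); apply.
  rewrite -[leLHS]mulrA [K * _]mulrC ler_wpM2l // ler_wpM2l ?lerDl //.
  by rewrite mulr_ge0 // addr_ge0.
have sumB : \sum_i `|(B *m x) i 0| <= n%:R + h * K * s.
  apply: le_trans (_ : \sum_(k < n) (1 + h * ((\sum_j `|D k j|) * s)) <= _).
    apply: ler_sum => k _; rewrite BxE; apply: le_trans (ler_normB _ _) _.
    by rewrite normr1 lerD2l normrM ger0_norm // ler_wpM2l.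
  by rewrite big_split /= sumr_const card_ord -mulr_sumr -mulr_suml mulrA.
move=> /le_trans/(_ sumB); rewrite BxE subr_gt0.
have hD : h * (D *m x) i 0 <= h * K * s.
  rewrite -mulrA ler_wpM2l //; apply: le_trans (ler_norm _) _.
  apply: le_trans (Dxk i) _; rewrite ler_wpM2r // /K [leRHS](bigD1 i) //= lerDl.
  by apply: sumr_ge0 => k _; apply: sumr_ge0.
move: hD hKs; set q := h * K * s; set N : R := n%:R => hD hKs cs.
have N0 : 0 <= N by exact: ler0n.
apply: le_lt_trans hD _; rewrite ltNge; apply/negP => q1.
have : 0 <= (q - 1) * N by rewrite mulr_ge0 ?subr_ge0.
lra.
Qed.

(** Continuation in [t]: the set [T] of good times contains its supremum by closedness, and openness
    would push it further if the supremum were below 1. *)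
Lemma semipositive_homotopy (R : realType) (n : nat) (A D : 'M[R]_n) :
  (forall t, 0 <= t <= 1 -> Z_matrix (A - t *: D)) ->
  (forall t (x : 'cV[R]_n), 0 <= t <= 1 -> lemx 0 x ->
     (A - t *: D) *m x = 0 -> x = 0) ->
  semipositive A -> semipositive (A - D).
Proof.
move=> ZA kerA SA.
pose T := [set t : R | 0 <= t <= 1 /\ semipositive (A - t *: D)].
have T0 : T 0 by split; rewrite ?lexx ?ler01 // scale0r subr0.
have Tub : ubound T 1 by move=> t [/andP[]].
have hT : has_sup T by split; [exists 0|exists 1].
have s0 : 0 <= sup T by exact: sup_upper_bound.
have s1 : sup T <= 1 by apply: ge_sup => //; exists 0.
have [e e0 eP] : exists2 e, 0 < e & forall h, 0 <= h <= e ->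
    Z_matrix (A - sup T *: D + h *: D) ->
    semipositive (A - sup T *: D + h *: D) -> semipositive (A - sup T *: D).
  by apply: semipositive_closed => x; apply: kerA; rewrite s0 s1.
have Ts : semipositive (A - sup T *: D).
  (* A good time within [e] of the supremum; [h = sup T - t] leads from the supremum back to it. *)
  have [t Tt tT] := sup_adherent e0 hT.
  have tE : A - sup T *: D + (sup T - t) *: D = A - t *: D.
    by rewrite -addrA -scaleNr -scalerDl addrA addNr add0r scaleNr.
  case: (Tt) => t01 St; apply: (eP (sup T - t)); rewrite ?tE //; last exact: ZA.
  by rewrite subr_ge0 sup_upper_bound //= lerBlDr addrC -lerBlDr ltW.
have [d d0 dP] := semipositive_open Ts.
move: s1; rewrite le_eqVlt => /orP[/eqP s1|s1]; first by rewrite s1 scale1r in Ts.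
pose u := Num.min 1 (sup T + d).
have su : sup T < u by rewrite lt_min s1 ltrDl.
have : T u.
  split; first by rewrite (le_trans s0 (ltW su)) ge_min lexx.
  apply: dP; rewrite ger0_norm ?subr_ge0 ?(ltW su) // lerBlDl.
  by rewrite ge_min lexx orbT.
by move/(sup_upper_bound hT); rewrite leNgt su.
Qed.

(** * Spectral radius and M-matrices *)

Lemma normc_sum (R : realType) (I : finType) (F : I -> R[i]) :
  ComplexField.Normc.normc (\sum_i F i) <=
  \sum_i ComplexField.Normc.normc (F i).
Proof.
elim/big_ind2: _ => //; first by rewrite ComplexField.Normc.normc0.
move=> a b c d ab cd; apply: le_trans (lerD ab cd).
exact: (@le_normcD R).
Qed.

Lemma normc_ge0 (R : realType) (x : R[i]) : 0 <= ComplexField.Normc.normc x.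
Proof. by case: x => a b; exact: sqrtr_ge0. Qed.

Lemma normc_real (R : realType) (a : R) :
  ComplexField.Normc.normc (real_complex R a) = `|a|.
Proof. by rewrite /= expr0n addr0 sqrtr_sqr. Qed.

(* Collatz-Wielandt: pair [|v| N] with [x] for a left eigenvector [v]. *)
Lemma eigenvalue_bound (R : realType) (n : nat) (N : 'M[R]_n) (x : 'cV[R]_n)
    (r : R) (l : R[i]) :
  lemx 0 N -> (forall i, 0 < x i 0) -> (forall i, (N *m x) i 0 <= r * x i 0) ->
  eigenvalue (map_mx (real_complex R) N) l -> ComplexField.Normc.normc l <= r.
Proof.
move=> N0 x0 Nx /eigenvalueP[v vN v0].
set nc := @ComplexField.Normc.normc R.
pose S := \sum_j nc (v 0 j) * x j 0.
have Sge j : 0 <= nc (v 0 j) * x j 0 by rewrite mulr_ge0 ?normc_ge0 // ltW.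
have S0 : 0 < S.
  have [j vj] : exists j, v 0 j != 0.
    apply/existsP; apply: contraR v0; rewrite negb_exists => /forallP v0.
    by apply/eqP/rowP => j; rewrite mxE; apply/eqP; move: (v0 j); rewrite negbK.
  rewrite /S (bigD1 j) //= ltr_wpDr ?sumr_ge0 // mulr_gt0 //.
  rewrite lt_neqAle normc_ge0 andbT eq_sym.
  by apply: contra vj => /eqP/ComplexField.Normc.eq0_normc ->.
rewrite -(ler_pM2r S0) /S !mulr_sumr.
(* The middle term is [|v| N x]: [v N = l v] bounds it below by [|l| S], and [N x <= r x] bounds it
   above by [r S]. *)
apply: le_trans (_ : \sum_j (\sum_i nc (v 0 i) * N i j) * x j 0 <= _).
  apply: ler_sum => j _; rewrite mulrA ler_wpM2r ?(ltW (x0 j)) //.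
  rewrite -ComplexField.Normc.normcM.
  have /rowP/(_ j) := vN; rewrite mxE [RHS]mxE => <-.
  apply: (le_trans (normc_sum _)); apply: ler_sum => i _.
  rewrite ComplexField.Normc.normcM mxE normc_real ger0_norm //.
  by have := N0 i j; rewrite mxE.
under eq_bigr do rewrite mulr_suml.
rewrite exchange_big /=; apply: ler_sum => i _.
under eq_bigr do rewrite -mulrA.
rewrite -mulr_sumr mulrCA ler_wpM2l ?normc_ge0 //.
by have := Nx i; rewrite mxE.
Qed.

(** Take [s] above every diagonal entry, so that [N = s I - A >= 0]. If [m > 0] is below all ratios
    [(A x)_i / x_i], then [N x <= (s - m) x], and the Collatz-Wielandt bound applies. *)
Lemma Z_semipositive_M_matrix (R : realType) (n : nat) (A : 'M[R]_n) :
  Z_matrix A -> semipositive A -> M_matrix A.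
Proof.
move=> ZA [x x0 Ax]; have {}x0 := Z_semipositive_gt0 ZA x0 Ax.
pose s := 1 + \sum_i `|A i i|.
have s1 : 1 <= s by rewrite /s lerDl sumr_ge0.
have N0 : lemx 0 (s%:M - A).
  move=> i j; rewrite !mxE; have [<-|ij] := eqVneq i j.
    rewrite mulr1n subr_ge0; apply: le_trans (ler_norm _) _.
    by rewrite /s (bigD1 i) //= addrCA lerDl addr_ge0 ?sumr_ge0.
  by rewrite mulr0n sub0r oppr_ge0 ZA.
have [m m0 mA] : exists2 m, 0 < m & forall i, m <= (A *m x) i 0 / x i 0.
  by apply: finite_lower_bound => i; rewrite divr_gt0.
exists (s%:M - A), s; split => //; last by rewrite opprB addrC subrK.
(* The [0] covers an empty spectrum, whose supremum is 0 by default; [s >= 1] still gives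
   [r < s]. *)
pose r := Num.max 0 (s - m).
have rs : r < s by rewrite gt_max (lt_le_trans ltr01 s1) gtrBl.
apply: le_lt_trans rs.
have [E0|/set0P E0] := eqVneq [set l | eigenvalue (map_mx (real_complex R) (s%:M - A)) l] set0.
  by rewrite /spectral_radius E0 image_set0 sup0 le_max lexx.
apply: ge_sup; first by case: E0 => l El; exists (ComplexField.Normc.normc l), l.
move=> _ [l El <-]; apply: (eigenvalue_bound N0 x0 _ El) => i.
have xi := x0 i; rewrite mulmxBl mul_scalar_mx 3!mxE.
apply: le_trans (_ : (s - m) * x i 0 <= _).
  by rewrite mulrBl lerB // -ler_pdivlMr // mA.
by rewrite ler_wpM2r ?(ltW xi) // le_max lexx orbT.
Qed.

Lemma M_matrix_Z (R : realType) (n : nat) (A : 'M[R]_n) :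
  M_matrix A -> Z_matrix A.
Proof.
move=> [N [s [N0 _ ->]]] i j ij; rewrite !mxE (negbTE ij) mulr0n sub0r oppr_le0.
by have := N0 i j; rewrite mxE.
Qed.

(** [eigenvalue] speaks of left eigenvectors, whereas kernel vectors along the path are right
    ones. *)
Lemma eigenvalue_tr (F : fieldType) (n : nat) (A : 'M[F]_n) (a : F) :
  eigenvalue A^T a = eigenvalue A a.
Proof.
rewrite /eigenvalue /eigenspace !kermx_eq0 !row_free_unit -unitmx_tr.
by rewrite raddfB /= trmxK tr_scalar_mx.
Qed.

(* With [b] a bound on the row sums of [N], follow [tI - N] from [t = b] down to
   [t = s]: a kernel vector on the way would make [t >= s] an eigenvalue. *)
Lemma M_matrix_semipositive (R : realType) (n : nat) (A : 'M[R]_n) :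
  M_matrix A -> semipositive A.
Proof.
move=> [N [s [N0 ps ->]]].
have N0' i j : 0 <= N i j by have := N0 i j; rewrite mxE.
pose b0 := \sum_i \sum_j N i j.
have b00 : 0 <= b0 by apply: sumr_ge0 => i _; apply: sumr_ge0.
have N1 i : (N *m (const_mx 1 : 'cV[R]_n)) i 0 <= b0.
  rewrite mxE; under eq_bigr do rewrite mxE mulr1.
  by rewrite /b0 [leRHS](bigD1 i) //= lerDl; apply: sumr_ge0 => k _; apply: sumr_ge0.
(* [b >= s] makes the path descend to [s]; [b > b0] makes [b I - N] send the all-ones vector to a
   positive one. *)
pose b := Num.max s (b0 + 1).
have sb : s <= b by rewrite le_max lexx.
have b0b : b0 < b by rewrite lt_max ltrDl ltr01 orbT.
have E t : b%:M - N - t *: (b - s)%:M = (b - t * (b - s))%:M - N.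
  by rewrite scale_scalar_mx [in RHS]raddfB /= addrAC.
have -> : s%:M - N = (b%:M - N) - (b - s)%:M.
  by have := E 1; rewrite scale1r mul1r subKr.
apply: semipositive_homotopy.
- move=> t _ i j ij; rewrite E !mxE (negbTE ij) mulr0n sub0r oppr_le0.
  exact: N0'.
- move=> t x /andP[t0 t1] x0; rewrite E; set u := b - _.
  have su : s <= u.
    by rewrite lerBrDr -lerBrDl ler_piMl // subr_ge0.
  move=> ux; apply/eqP; apply: contraLR ps => xn0; rewrite -leNgt.
  have Eu : eigenvalue (map_mx (real_complex R) N) (real_complex R u).
    (* The characteristic polynomial brings the question from the complex numbers back to [R], where
       [x^T] is a left eigenvector of [N^T]. *)
    rewrite eigenvalue_root_char -map_char_poly fmorph_root.
    rewrite -eigenvalue_root_char -eigenvalue_tr; apply/eigenvalueP; exists x^T.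
      rewrite -trmx_mul -linearZ /=; congr trmx; apply/esym/eqP.
      by rewrite -subr_eq0 -mul_scalar_mx -mulmxBl ux.
    by apply: contra xn0 => /eqP/(congr1 trmx); rewrite trmxK trmx0 => ->.
  apply: le_trans su _; apply: le_trans (ler_norm _) _; rewrite -normc_real.
  apply: ub_le_sup; last by exists (real_complex R u).
  (* The supremum dominates its members only if the moduli are bounded; Collatz-Wielandt with the
     all-ones vector bounds them. *)
  exists b0 => _ [l El <-].
  apply: (eigenvalue_bound N0 (x := const_mx 1) _ _ El) => i; first by rewrite mxE.
  by rewrite [X in _ * X]mxE mulr1.
- exists (const_mx 1); first by apply/lemx0P => i; rewrite mxE.
  move=> i; rewrite -[N]scale1r mulmx_pencilE mul1r subr_gt0.
  by rewrite (le_lt_trans (N1 i)) // mul_scalar_mx !mxE mulr1.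
Qed.

Theorem proposition15 (R : realType) (n : nat) (Al Au : 'M[R]_n)
    (le_Al_Au : lemx Al Au)
    (Ac_M : M_matrix (midpoint_mx Al Au)) :
  strongly (@R0_matrix R n) (interval_mx Al Au) <->
  strongly (@H_matrix R n) (interval_mx Al Au).
Proof.
set Ac := midpoint_mx Al Au in Ac_M.
split=> [R0A A [AlA AAu]|HA A /HA HA' y z yE y0 z0 yz].
  pose D := Ac - Al.
  have AcE i j : Ac i j = (Al i j + Au i j) / 2 by rewrite !mxE mulrC.
  (* For [0 <= t <= 1] this is a convex combination, so the path stays in the interval. *)
  have tE t i j : (Ac - t *: D) i j = (1 - t) * Ac i j + t * Al i j.
    by rewrite !mxE; ring.
  have ZAc := M_matrix_Z Ac_M.
  have SAl : semipositive Al.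
    have -> : Al = Ac - D by rewrite /D opprB addrC subrK.
    apply: semipositive_homotopy (M_matrix_semipositive Ac_M).
      move=> t /andP[t0 t1] i j ij; rewrite tE.
      have Ac0 := ZAc i j ij; have Al0 : Al i j <= 0.
        by have := AcE i j; have := le_Al_Au i j; lra.
      have : 0 <= (1 - t) * - Ac i j by rewrite mulr_ge0 ?subr_ge0 ?oppr_ge0.
      have : 0 <= t * - Al i j by rewrite mulr_ge0 ?oppr_ge0.
      lra.
    move=> t x /andP[t0 t1] x0 Ax0.
    (* A nonnegative kernel vector solves the complementarity problem with [y = 0]. *)
    apply: (R0A (Ac - t *: D) _ 0 x); rewrite ?Ax0 ?trmx0 ?mul0mx //.
    split=> i j; rewrite tE AcE; have := le_Al_Au i j => le_ij.
      have : 0 <= (1 - t) * (Au i j - Al i j) by rewrite mulr_ge0 ?subr_ge0.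
      lra.
    have : 0 <= t * (Au i j - Al i j) by rewrite mulr_ge0 ?subr_ge0.
    lra.
  apply: Z_semipositive_M_matrix.
    by move=> i j ij; rewrite mxE (negbTE ij) oppr_le0.
  case: SAl => x x0 Alx; exists x => // i; apply: lt_le_trans (Alx i) _.
  rewrite !mxE; apply: ler_sum => j _; rewrite ler_wpM2r //.
    by move/lemx0P: x0.
  rewrite mxE; have := AlA i j; have := AAu i j; case: eqVneq => [<-|ij].
    by move=> _ /le_trans; apply; exact: ler_norm.
  (* Off the diagonal [Al + Au <= 0], so [Al <= A <= Au <= - Al] and thus [- |A i j| >= Al i j]. *)
  have := ZAc i j ij; rewrite AcE => Ac0 Au_ij Al_ij.
  by rewrite lerNr ler_norml; apply/andP; split; lra.
have Zz : lemx 0 (- z).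
  have ZC := M_matrix_Z HA'; have SC := M_matrix_semipositive HA'.
  apply: (Z_semipositive_monotone ZC SC); apply/lemx0P => i.
  rewrite mulmxN mxE oppr_ge0.
  move/lemx0P: y0 => y0; move/lemx0P: z0 => z0.
  have yzi : y i 0 * z i 0 = 0.
    have /eqP := congr1 (fun M : 'M_1 => M 0 0) yz.
    rewrite /= !mxE psumr_eq0; last by move=> k _; rewrite mxE mulr_ge0.
    by move=> /allP/(_ i); rewrite mem_index_enum mxE => /(_ isT)/eqP.
  rewrite mxE (bigD1 i) //= mxE eqxx.
  under eq_bigr => j ji do rewrite mxE eq_sym (negbTE ji) mulNr.
  rewrite sumrN subr_le0.
  have Sj : 0 <= \sum_(j | j != i) `|A i j| * z j 0.
    by apply: sumr_ge0 => j _; rewrite mulr_ge0.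
  (* If [z i 0] is nonzero, complementarity gives [y i 0 = 0]: the diagonal term of [A z] cancels
     the off-diagonal ones, and the triangle inequality concludes. *)
  have [->|zi] := eqVneq (z i 0) 0; first by rewrite mulr0.
  have yi : y i 0 = 0 by move/eqP: yzi; rewrite mulf_eq0 (negbTE zi) orbF => /eqP.
  move: yi; rewrite yE mxE (bigD1 i) //= => /eqP; rewrite addr_eq0 => /eqP Azi.
  rewrite -(ger0_norm (z0 i)) -normrM Azi normrN.
  apply: le_trans (ler_norm_sum _ _ _) _; apply: ler_sum => j _.
  by rewrite normrM (ger0_norm (z0 j)).
apply/colP => i; apply/le_anti; rewrite [X in _ <= X <= _]mxE.
by have := z0 i 0; have := Zz i 0; rewrite !mxE oppr_ge0 => -> ->.
Qed.
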